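(* Let $\mathfrak{g}$ be a $6$-dimensional (non-Kähler, i.e. not admitting Kähler structures) strongly unimodular almost nilpotent real Lie algebra with nilradical $\mathfrak{n}$ satisfying $\dim\mathfrak{n}^1=1$, where $\mathfrak{n}^1=[\mathfrak{n},\mathfrak{n}]$. Then $\mathfrak{g}$ does not admit generalized Kähler structures $(J_+,J_-,g)$ such that $J_+(\mathfrak{n}^1)=\mathfrak{n}^{\perp_g}$.
   Context: The nilradical $\mathfrak{n}$ of a solvable Lie algebra $\mathfrak{g}$ is its maximal nilpotent ideal; $\mathfrak{g}$ is almost nilpotent if it is solvable and $\mathfrak{n}$ has codimension one. With $\mathfrak{n}^0=\mathfrak{n}$, $\mathfrak{n}^{l}=[\mathfrak{n},\mathfrak{n}^{l-1}]$, a solvable $\mathfrak{g}$ is strongly unimodular if $\operatorname{tr}(\mathrm{ad}_X|_{\mathfrak{n}^l/\mathfrak{n}^{l+1}})=0$ for all $X\in\mathfrak{g}$, $l\in\mathbb{N}$. A generalized Kähler structure on $\mathfrak{g}$ is a triple $(J_+,J_-,g)$ where $J_\pm$ are integrable complex structures on $\mathfrak{g}$ and $g$ is a positive definite inner product orthogonal with respect to both, such that $dd^c_\pm\omega_\pm=0$ and $d^c_+\omega_++d^c_-\omega_-=0$, where $\omega_\pm=g(J_\pm\cdot,\cdot)$, $d$ is the Chevalley–Eilenberg differential and $d^c_\pm=i(\overline\partial_\pm-\partial_\pm)$ with respect to $J_\pm$. A Kähler structure is a Hermitian structure $(J,g)$ with $d\omega=0$. $\mathfrak{n}^{\perp_g}$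 is the $g$-orthogonal complement of $\mathfrak{n}$. *)

(* Defs.v *)
From HB Require Import structures.
From mathcomp Require Import all_boot all_order all_algebra.
From mathcomp Require Import reals complex.

Set Implicit Arguments.
Unset Strict Implicit.
Unset Printing Implicit Defensive.

Import GRing.Theory Num.Theory.
Local Open Scope ring_scope.

HB.mixin Record Lmodule_isLieAlgebra (K : comNzRingType) L
    of GRing.Lmodule K L := {
  lie : L -> L -> L;
  lie_linearl : forall y, linear (lie^~ y);
  lie_linearr : forall x, linear (lie x);
  liexx : forall x, lie x x = 0;
  lie_jacobi : forall x y z,
    lie x (lie y z) + lie y (lie z x) + lie z (lie x y) = 0
}.

#[short(type="lieAlgType")]
HB.structure Definition LieAlgebra (K : comNzRingType) :=
  {L of Lmodule_isLieAlgebra K L & GRing.Lmodule K L}.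

#[short(type="finLieAlgType")]
HB.structure Definition FinLieAlgebra (K : comNzRingType) :=
  {L of Lmodule_isLieAlgebra K L & Vector K L}.

HB.instance Definition _ (K : comNzRingType) (L : lieAlgType K) :=
  bilinear_isBilinear.Build K L L L *:%R *:%R (@lie K L)
    (@lie_linearl K L, @lie_linearr K L).

Lemma lie_antisym (K : comNzRingType) (L : lieAlgType K) (x y : L) :
  lie x y = - lie y x.
Proof.
apply/eqP; rewrite -addr_eq0; apply/eqP.
have := liexx (x + y).
by rewrite linearDl !linearDr /= !liexx add0r addr0.
Qed.

Definition end_trace (F : fieldType) (V : vectType F) (f : 'End(V)) : F :=
  \tr (passmx.mxof (vbasis {:V}) (vbasis {:V}) f).

Section Subspaces.
Variables (F : fieldType) (L : finLieAlgType F).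
Implicit Types (x y : L) (U W n : {vspace L}).

Definition ad x : 'End(L) := linfun (lie x).

Definition lie_space U W : {vspace L} :=
  <<[seq lie x y | x <- vbasis U, y <- vbasis W]>>%VS.

Lemma mem_lie_space U W x y : x \in U -> y \in W -> lie x y \in lie_space U W.
Proof.
move=> /coord_vbasis -> /coord_vbasis ->.
rewrite linear_sumlz; apply: memv_suml => i _.
rewrite linear_sumr; apply: memv_suml => j _ /=.
rewrite linearZl_LR linearZr /=; do 2!apply: memvZ.
apply: memv_span; apply/allpairsP.
by exists ((vbasis U)`_i, (vbasis W)`_j); rewrite !mem_nth ?size_tuple.
Qed.

Lemma lie_space_subP U W (Z : {vspace L}) :
  reflect {in U & W, forall x y, lie x y \in Z} (lie_space U W <= Z)%VS.
Proof.
apply: (iffP idP) => [/subvP sZ x y xU yW|sZ].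
  by apply: sZ; apply: mem_lie_space.
apply/span_subvP => _ /allpairsP [[x y] /= [xU yW ->]].
by apply: sZ; apply: vbasis_mem.
Qed.

Fixpoint lower_central n (l : nat) : {vspace L} :=
  if l is l'.+1 then lie_space n (lower_central n l') else n.

Fixpoint derived_series n (l : nat) : {vspace L} :=
  if l is l'.+1 then lie_space (derived_series n l') (derived_series n l')
  else n.

Definition is_ideal n : Prop := forall x y, y \in n -> lie x y \in n.

Definition is_nilpotent n : Prop := exists l, lower_central n l = 0%VS.

Definition is_solvable : Prop := exists l, derived_series fullv l = 0%VS.

Definition is_nilradical n : Prop :=
  [/\ is_ideal n, is_nilpotent n
    & forall m, is_ideal m -> is_nilpotent m -> (m <= n)%VS].

Definition almost_nilpotent n : Prop :=
  [/\ is_solvable, is_nilradical n & \dim {:L} = (\dim n).+1].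

(* For W <= U, the quotient U / W is modelled on the complement U :\: W of W
   in U, with the projection along W as canonical surjection; see quot_reprK,
   quot_proj_eq0 and quot_endE. *)
Definition quot_space U W := subvs_of (U :\: W)%VS.

Definition quot_proj U W : 'Hom(L, quot_space U W) :=
  (linfun (vsproj (U :\: W)%VS) \o addv_pi1 U W)%VF.

Definition quot_repr U W : 'Hom(quot_space U W, L) := linfun vsval.

Definition quot_end U W (f : 'End(L)) : 'End(quot_space U W) :=
  (quot_proj U W \o f \o quot_repr U W)%VF.

Lemma quot_repr_mem U W (v : quot_space U W) : quot_repr U W v \in U.
Proof. by rewrite lfunE /=; apply: (subvP (diffvSl U W)); apply: subvsP. Qed.

Lemma quot_reprK U W : cancel (quot_repr U W) (quot_proj U W).
Proof.
move=> v; rewrite comp_lfunE !lfunE /=.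
by rewrite [addv_pi1 _ _ _]daddv_pi_id ?capv_diff ?subvsP // vsvalK.
Qed.

Lemma quot_proj_eq0 U W (x : L) : (W <= U)%VS -> x \in U ->
  (quot_proj U W x == 0) = (x \in W).
Proof.
move=> sWU xU; rewrite comp_lfunE lfunE /=.
have xUW : x \in (U + W)%VS by apply: subvP (addvSl _ _) _ xU.
have dec := addv_pi1_pi2 xUW.
have p1D : addv_pi1 U W x \in (U :\: W)%VS by apply: memv_pi.
apply/eqP/idP => [/(congr1 vsval)|xW].
  rewrite vsprojK // linear0 => p1; rewrite -dec p1 add0r.
  exact: memv_pi2.
suff -> : addv_pi1 U W x = 0 by rewrite linear0.
apply/eqP; rewrite -memv0 -(capv_diff U W) memv_cap p1D /=.
by rewrite -[addv_pi1 U W x](addrK (addv_pi2 U W x)) dec rpredB ?memv_pi2.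
Qed.

Lemma quot_endE U W (f : 'End(L)) x : (W <= U)%VS ->
    (f @: U <= U)%VS -> (f @: W <= W)%VS -> x \in U ->
  quot_end U W f (quot_proj U W x) = quot_proj U W (f x).
Proof.
move=> sWU sfU sfW xU; set y := quot_repr U W (quot_proj U W x).
have yU : y \in U by apply: quot_repr_mem.
have fU z : z \in U -> f z \in U.
  by move=> zU; apply: (subvP sfU); apply: memv_img.
have yxW : y - x \in W.
  by rewrite -(quot_proj_eq0 sWU) ?rpredB // linearB /= quot_reprK subrr.
have -> : quot_end U W f (quot_proj U W x) = quot_proj U W (f y).
  by rewrite /quot_end !(comp_lfunE, lfunE).
apply/eqP; rewrite -subr_eq0 -raddfB quot_proj_eq0 //; last first.
  by rewrite rpredB ?fU.
by rewrite -raddfB; apply: (subvP sfW); apply: memv_img.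
Qed.

Definition strongly_unimodular n : Prop := forall (x : L) (l : nat),
  end_trace
    (quot_end (lower_central n l) (lower_central n l.+1) (ad x)) = 0.

End Subspaces.

Definition kform (K : comNzRingType) (L : lieAlgType K) (k : nat) : Type :=
  {ffun 'I_k -> L} -> K.

(* d a (x_0, .., x_k) =
     \sum_(i < j) (-1)^(i + j) a ([x_i, x_j], x_0, .., ^x_i, .., ^x_j, .., x_k).
   A pair i < j is encoded by j : 'I_k.+2 and i : 'I_k.+1; then x_i is
   x (lift j i). Degree 0, where d = 0, is left out. *)
Definition ce_d (K : comNzRingType) (L : lieAlgType K) (k : nat)
    (a : kform L k.+1) : kform L k.+2 := fun x =>
  \sum_(j < k.+2) \sum_(i < k.+1 | (i < j)%N)
    (-1) ^+ (i + j) *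
      a [ffun m => if unlift ord0 m is Some m' then x (lift j (lift i m'))
                   else lie (x (lift j i)) (x j)].

(* The pair (x, y) stands for x + i y. *)
Definition cplx (R : rcfType) (V : lmodType R) : Type := (V * V)%type.

HB.instance Definition _ (R : rcfType) (V : lmodType R) :=
  GRing.Zmodule.on (cplx V).

Section ComplexScaling.
Variables (R : rcfType) (V : lmodType R).
Implicit Types (c : R[i]) (u : cplx V).

Definition cplx_scale c u : cplx V :=
  (complex.Re c *: u.1 - complex.Im c *: u.2,
   complex.Re c *: u.2 + complex.Im c *: u.1).

Fact cplx_scaleA a b u : cplx_scale a (cplx_scale b u) = cplx_scale (a * b) u.
Proof.
case: a b u => [a1 a2] [b1 b2] [u1 u2]; rewrite /cplx_scale /=.
rewrite !scalerDr !scalerN !scalerBl !scalerDl !scalerA !opprD !addrA.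
by congr pair; rewrite [LHS]addrAC; congr (_ + _); rewrite addrAC.
Qed.

Fact cplx_scale1 : left_id 1 cplx_scale.
Proof. by case=> u1 u2; rewrite /cplx_scale /= !scale1r !scale0r subr0 addr0. Qed.

Fact cplx_scaleDr : right_distributive cplx_scale +%R.
Proof.
move=> [a1 a2] [u1 u2] [v1 v2]; rewrite /cplx_scale /= !scalerDr !opprD.
by congr pair; rewrite addrACA.
Qed.

Fact cplx_scaleDl u : {morph cplx_scale^~ u : a b / a + b}.
Proof.
case: u => u1 u2 [a1 a2] [b1 b2]; rewrite /cplx_scale /= !scalerDl !opprD.
by congr pair; rewrite addrACA.
Qed.

HB.instance Definition _ := GRing.Zmodule_isLmodule.Build R[i] (cplx V)
  cplx_scaleA cplx_scale1 cplx_scaleDr cplx_scaleDl.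

Lemma cplx_scaleE c u : c *: u = cplx_scale c u.
Proof. by []. Qed.

End ComplexScaling.

Section ComplexBracket.
Variables (R : rcfType) (L : lieAlgType R).
Implicit Types u v w : cplx L.

Definition cplx_lie u v : cplx L :=
  (lie u.1 v.1 - lie u.2 v.2, lie u.1 v.2 + lie u.2 v.1).

Fact cplx_lie_linearl v : linear (cplx_lie^~ v).
Proof.
move=> [c1 c2] [u1 u2] [w1 w2]; rewrite !cplx_scaleE /cplx_scale /cplx_lie /=.
rewrite !(linearDl, linearNl, linearZl_LR) /= !scalerDr !scalerN !opprD !addrA.
by congr pair; rewrite /= !addrA [LHS](ACl (1*4*5*2*3*6)).
Qed.

Fact cplx_lie_linearr u : linear (cplx_lie u).
Proof.
move=> [c1 c2] [v1 v2] [w1 w2]; rewrite !cplx_scaleE /cplx_scale /cplx_lie /=.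
rewrite !(linearDr, linearNr, linearZr_LR) /= !scalerDr !scalerN !opprD !addrA.
by congr pair; rewrite /= !addrA [LHS](ACl (1*4*2*5*3*6)).
Qed.

Fact cplx_liexx u : cplx_lie u u = 0.
Proof.
by rewrite /cplx_lie !liexx subrr [lie u.2 _]lie_antisym subrr.
Qed.

Fact cplx_lie_jacobi u v w :
  cplx_lie u (cplx_lie v w) + cplx_lie v (cplx_lie w u)
    + cplx_lie w (cplx_lie u v) = 0.
Proof.
case: u v w => [u1 u2] [v1 v2] [w1 w2]; rewrite /cplx_lie /=.
rewrite !(linearDr, linearNr) /= !opprD.
congr pair => /=.
  rewrite !addrA [LHS](ACl ((1*5*9)*(2*8*11)*(3*6*12)*(4*7*10))) /=.
  by rewrite -!opprD !lie_jacobi !oppr0 !addr0.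
rewrite !addrA [LHS](ACl ((1*6*11)*(2*7*9)*(3*5*10)*(4*8*12))) /=.
by rewrite -!opprD !lie_jacobi !oppr0 !addr0.
Qed.

HB.instance Definition _ := Lmodule_isLieAlgebra.Build R[i] (cplx L)
  cplx_lie_linearl cplx_lie_linearr cplx_liexx cplx_lie_jacobi.

(* The complex multilinear extension: S is the set of slots that receive the
   imaginary part. *)
Definition cplx_form k (a : kform L k) : kform (cplx L) k := fun x =>
  \sum_(S : {set 'I_k}) 'i%C ^+ #|S| *
    (a [ffun m => if m \in S then (x m).2 else (x m).1])%:C%C.

End ComplexBracket.

Section ComplexStructures.
Variables (R : realType) (L : finLieAlgType R).
Implicit Types (J : 'End(L)) (g : {dot L for idfun}).

Definition cplx_end J (u : cplx L) : cplx L := (J u.1, J u.2).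

Definition proj10 J (u : cplx L) : cplx L :=
  2^-1 *: (u - 'i%C *: cplx_end J u).
Definition proj01 J (u : cplx L) : cplx L :=
  2^-1 *: (u + 'i%C *: cplx_end J u).

(* The component of type (p, k - p) of a complex k-form. *)
Definition type_proj J k (p : nat) (a : kform (cplx L) k) : kform (cplx L) k :=
  fun x => \sum_(S : {set 'I_k} | #|S| == p)
    a [ffun m => if m \in S then proj10 J (x m) else proj01 J (x m)].

(* On forms of type (p, q), del and delbar are the components of d of type
   (p + 1, q) and (p, q + 1); they extend to all forms by summing over the
   types with p + q = k.+1. *)
Definition del J k (a : kform (cplx L) k.+1) : kform (cplx L) k.+2 :=
  fun x => \sum_(p < k.+2) type_proj J p.+1 (ce_d (type_proj J p a)) x.

Definition delbar J k (a : kform (cplx L) k.+1) : kform (cplx L) k.+2 :=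
  fun x => \sum_(p < k.+2) type_proj J p (ce_d (type_proj J p a)) x.

Definition dc J k (a : kform (cplx L) k.+1) : kform (cplx L) k.+2 :=
  fun x => 'i%C * (delbar J a x - del J a x).

Definition nijenhuis J (x y : L) : L :=
  lie (J x) (J y) - J (lie (J x) y) - J (lie x (J y)) - lie x y.

Definition complex_structure J : Prop :=
  (forall x, J (J x) = - x) /\ (forall x y, nijenhuis J x y = 0).

Definition hermitian_structure J g : Prop :=
  complex_structure J /\ (forall x y, g (J x) (J y) = g x y).

Definition fundamental_form J g : kform L 2 :=
  fun x => g (J (x ord0)) (x ord_max).

Definition kahler_structure J g : Prop :=
  hermitian_structure J g /\ (forall x, ce_d (fundamental_form J g) x = 0).

Definition generalized_kahler_structure Jp Jm g : Prop :=
  let omegap := cplx_form (fundamental_form Jp g) in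
  let omegam := cplx_form (fundamental_form Jm g) in
  [/\ hermitian_structure Jp g, hermitian_structure Jm g,
      (forall x, ce_d (dc Jp omegap) x = 0),
      (forall x, ce_d (dc Jm omegam) x = 0)
    & (forall x, dc Jp omegap x + dc Jm omegam x = 0)].

End ComplexStructures.

(* Main.v *)
Require Import Defs.
From HB Require Import structures.
From mathcomp Require Import all_boot all_order all_algebra.
From mathcomp Require Import boolp reals complex ring lra.

(* Write T(x, y, z) = h([Jx, Jy], z) + (cyclic); for a Hermitian structure
   (J, h) this is d^c omega, so a generalized Kaehler structure gives dT_+ = 0
   and T_- = - T_+.

   Let e1 be a unit vector of n^1 and e6 = J_+ e1, which spans the orthogonal of
   n. Nilpotency and strong unimodularity make e1 central. Put A = ad e6 and
   eta = h([., .], e1). Integrability of J_+ gives A J_+ = J_+ A, whence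
   [x, y] = eta(x, y) e1 + h(x, e6) A y - h(y, e6) A x. One component of
   dT_+ = 0 says h(A^2 x, y) + 2 h(A x, A y) + h(x, A^2 y) = 0, which forces A
   to be skew; then T_+ = e^1 /\ eta and dT_+ = 0 becomes eta /\ eta = 0.

   For I = J_-, put u = I e1 and f = I e6. Integrability of I and T_- = - T_+
   yield eta(f, .) = - h(A u, .), eta(u, I .) = h(u, e6) h(A u, .),
   eta(u, f) = 0 and I A u = - h(u, e6) A f; together with eta /\ eta = 0 these
   give A u = 0 and eta(u, .) = 0. So eta(I x, y) = eta(x, I y), hence
   eta(x, I x) = 0, and eta /\ eta = 0 on (x, y, I x, I y) reads
   eta(x, y)^2 + eta(x, I y)^2 = 0. Thus eta = 0 and n is abelian, which
   contradicts dim n^1 = 1. *)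

Set Implicit Arguments.
Unset Strict Implicit.
Unset Printing Implicit Defensive.

Import Order.TTheory GRing.Theory Num.Theory.
Local Open Scope ring_scope.

Local Notation bilinE := (linearDl, linearBl, linearNl, linearZl_LR,
  linearDr, linearBr, linearNr, linearZr_LR).

(** * Scalar products *)

Section Frames.
Variables (R : realType) (L : vectType R) (h : {dot L for idfun}).

Lemma dotC x y : h x y = h y x.
Proof. by rewrite hermC expr0 mul1r. Qed.

Lemma dot_gt0 x : (0 < h x x) = (x != 0).
Proof.
have [->|/neq0_dnorm_gt0->//] := eqVneq x 0.
by rewrite linear0l ltxx.
Qed.

Lemma orthogonal_skew (J : 'End(L)) x y :
  (forall z, J (J z) = - z) -> (forall z t, h (J z) (J t) = h z t) ->
  h x (J y) = - h (J x) y.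
Proof. by move=> JJ Jh; rewrite -[in RHS](Jh (J x)) JJ linearNl opprK. Qed.

Lemma unit_vector (U : {vspace L}) :
  U != 0%VS -> exists2 u, u \in U & h u u = 1.
Proof.
move=> U0; exists ((Num.sqrt (h (vpick U) (vpick U)))^-1 *: vpick U).
  by rewrite memvZ ?memv_pick.
have n0 : 0 < h (vpick U) (vpick U) by rewrite dot_gt0 vpick0.
rewrite linearZl_LR linearZr_LR /= mulrA -expr2 exprVn sqr_sqrtr ?ltW //.
by rewrite mulVf ?gt_eqF.
Qed.

(** Gram-Schmidt: split off a unit vector and recurse on its orthogonal in [U]. The list is an
    orthonormal basis, recorded through its expansion formula. *)
Lemma parseval_frame (U : {vspace L}) : exists2 s : seq L, {subset s <= U} &
  {in U, forall x, x = \sum_(a <- s) h x a *: a}.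
Proof.
have [k] := ubnP (\dim U); elim: k U => // k IHk U; rewrite ltnS => dimU.
have [->|U0] := eqVneq U 0%VS.
  by exists [::] => // x; rewrite memv0 big_nil => /eqP.
have [u uU hu] := unit_vector U0.
have [|s sU Hs] := IHk (U :&: orthov h <[u]>)%VS.
  rewrite -(eq_dim_orthov1 (u := u) (V := U)).
    by rewrite prednK // lt0n dimv_eq0.
  apply/mem_orthovPn; exists u => //; apply/eqP => hu0.
  by have /eqP := etrans (esym hu) hu0; rewrite oner_eq0.
exists (u :: s) => [a|x xU].
  by rewrite inE => /predU1P [->//|/sU]; rewrite memv_cap => /andP [].
have /Hs : x - h x u *: u \in (U :&: orthov h <[u]>)%VS.
  rewrite memv_cap rpredB ?memvZ //= mem_orthov1; apply/eqP.
  have : h (x - h x u *: u) u = 0.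
    by rewrite linearBl linearZl_LR /= hu mulr1 subrr.
  exact.
move=> Ey; rewrite big_cons -[LHS](subrK (h x u *: u)) {1}Ey addrC.
congr (_ + _); rewrite !big_seq; apply: eq_bigr => a /sU.
rewrite memv_cap mem_orthov1 => /andP [_ /eqP au].
have ua : h u a = 0 by rewrite dotC; exact: au.
by rewrite linearBl linearZl_LR /= ua mulr0 subr0.
Qed.

(* Summing the hypothesis over a frame gives
   \sum_(a, b) (h (A a) b + h (A b) a) ^ 2 = 0. *)
Lemma skew_of_second_derivative (A : L -> L) : linear A ->
  (forall x y, h (A (A x)) y + h (A x) (A y) *+ 2 + h x (A (A y)) = 0) ->
  forall x y, h (A x) y = - h x (A y).
Proof.
move=> linA HA.
pose Al : {linear L -> L} := HB.pack A (GRing.isLinear.Build _ _ _ _ A linA).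
have [s _ Hs] := parseval_frame fullv.
have frame x : x = \sum_(a <- s) h x a *: a by apply: Hs; rewrite memvf.
have AE x : A x = Al x by [].
have dotE x y : h x y = \sum_(a <- s) h x a * h a y.
  rewrite [in LHS](frame x) linear_sumlz /=; apply: eq_bigr => a _.
  by rewrite linearZl_LR.
have A_dotE x y :
    h (A x) y = \sum_(a <- s) \sum_(b <- s) h x a * h y b * h (A a) b.
  rewrite {1}(frame x) AE linear_sum linear_sumlz; apply: eq_bigr => a _.
  rewrite linearZ linearZl_LR /= [h _ y]dotE mulr_sumr; apply: eq_bigr => b _.
  by rewrite (dotC b y) [h _ b * _]mulrC mulrA.
pose M a b := h (A a) b.
(* The hypothesis at x = y = a, halved and expanded in the frame. *)
have S0 a : \sum_(b <- s) (M a b * M b a + M a b * M a b) = 0.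
  have := HA a a; rewrite (dotC a) mulr2n.
  have -> : h (A (A a)) a = \sum_(b <- s) M a b * M b a.
    rewrite {1}(frame (A a)) AE linear_sum linear_sumlz; apply: eq_bigr => b _.
    by rewrite linearZ linearZl_LR.
  rewrite [h (A a) (A a)]dotE.
  under [\sum_(b <- s) _ * h _ (A a)]eq_bigr do rewrite (dotC _ (A a)).
  rewrite big_split /= -/(M _); lra.
have : \sum_(a <- s) \sum_(b <- s) (M a b + M b a) ^+ 2 = 0.
  (* Each square expands into the summand of [S0] at (a, b) plus the one at (b, a). *)
  transitivity (\sum_(a <- s) \sum_(b <- s) (M a b * M b a + M a b * M a b) +
     \sum_(a <- s) \sum_(b <- s) (M a b * M b a + M a b * M a b)); last first.
    by rewrite !big1 ?addr0.
  rewrite [X in _ + X]exchange_big -big_split; apply: eq_bigr => a _ /=.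
  by rewrite -big_split; apply: eq_bigr => b _ /=; ring.
move/eqP; rewrite psumr_eq0 => [|a _]; last first.
  by apply: sumr_ge0 => b _; apply: sqr_ge0.
move=> /allP S1 x y; rewrite (dotC x) !A_dotE exchange_big -sumrN !big_seq.
apply: eq_bigr => a sa; rewrite -sumrN !big_seq; apply: eq_bigr => b sb.
have /eqP := S1 _ sa.
move/eqP; rewrite /= psumr_eq0 => [/allP /(_ _ sb)|c _]; last exact: sqr_ge0.
rewrite /= sqrf_eq0 addr_eq0 => /eqP; rewrite /M => ->.
by rewrite mulrN opprK [h x b * _]mulrC.
Qed.

End Frames.

(** * Alternating forms in low degree *)

Section SmallTuples.
Variable V : zmodType.

Definition vec2 (u v : V) : {ffun 'I_2 -> V} := [ffun m : 'I_2 => [:: u; v]`_m].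
Definition vec3 (u v t : V) : {ffun 'I_3 -> V} :=
  [ffun m : 'I_3 => [:: u; v; t]`_m].
Definition vec4 (u v t s : V) : {ffun 'I_4 -> V} :=
  [ffun m : 'I_4 => [:: u; v; t; s]`_m].

Lemma vec2E (x : {ffun 'I_2 -> V}) : x = vec2 (x ord0) (x ord_max).
Proof.
by apply/ffunP => -[[|[|[]]] i] //; rewrite ffunE; congr (x _); apply: val_inj.
Qed.

End SmallTuples.

(** Truth tables of subsets: they turn the sums over sets of slots in [cplx_form] and [type_proj]
    into sums over booleans that compute. *)
Definition bool_set k (s : seq bool) : {set 'I_k} :=
  [set m : 'I_k | nth false s m].

Lemma sum_set2 (V : zmodType) (F : {set 'I_2} -> V) (P : pred {set 'I_2}) :
  \sum_(S | P S) F S =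
  \sum_(a : bool) \sum_(b : bool)
     (if P (bool_set 2 [:: a; b]) then F (bool_set 2 [:: a; b]) else 0).
Proof.
rewrite pair_bigA big_mkcond /=.
rewrite (reindex (fun p : bool * bool => bool_set 2 [:: p.1; p.2])) //.
exists (fun S : {set 'I_2} => (ord0 \in S, ord_max \in S)) => [[a b] _|S _].
  by rewrite !inE.
by apply/setP => -[[|[|[]]] i] //; rewrite !inE; congr (_ \in S); apply: val_inj.
Qed.

Lemma sum_set3 (V : zmodType) (F : {set 'I_3} -> V) (P : pred {set 'I_3}) :
  \sum_(S | P S) F S =
  \sum_(a : bool) \sum_(b : bool) \sum_(c : bool)
     (if P (bool_set 3 [:: a; b; c]) then F (bool_set 3 [:: a; b; c]) else 0).
Proof.
pose G a b c :=
  if P (bool_set 3 [:: a; b; c]) then F (bool_set 3 [:: a; b; c]) else 0.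
transitivity (\sum_(p : bool * (bool * bool)) G p.1 p.2.1 p.2.2); last first.
  rewrite -(pair_bigA _ (fun a q => G a q.1 q.2)); apply: eq_bigr => a _ /=.
  by rewrite -(pair_bigA _ (fun b c => G a b c)).
rewrite big_mkcond /=.
rewrite (reindex (fun p : bool * (bool * bool) =>
  bool_set 3 [:: p.1; p.2.1; p.2.2])) //.
exists (fun S : {set 'I_3} => (ord0 \in S, (inord 1 \in S, ord_max \in S))).
  by move=> [a [b c]] _; rewrite !inE inordK.
move=> S _; apply/setP => -[[|[|[|[]]]] i] //; rewrite !inE;
  by congr (_ \in S); apply: val_inj; rewrite /= ?inordK.
Qed.

Lemma card_bool_set k s : #|bool_set k s| = (\sum_(i < k) nth false s i)%N.
Proof.
by rewrite -sum1_card big_mkcond /=; apply: eq_bigr => i _; rewrite inE; case: nth.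
Qed.

Section ChevalleyEilenberg.
Variables (K : comNzRingType) (L : lieAlgType K).

Lemma ce_d2E (a : kform L 2) u v t : ce_d a (vec3 u v t) =
  - a (vec2 (lie u v) t) + a (vec2 (lie u t) v) - a (vec2 (lie v t) u).
Proof.
have sgn n (b : K) : (-1) ^+ n.+2 * b = (-1) ^+ n * b.
  by rewrite -addn2 exprD sqrrN expr1n mulr1.
rewrite /ce_d !big_ord_recl big_ord0.
(* The summand j = 0 is empty, as no index satisfies i < 0. *)
rewrite big_pred0 // !(big_mkcond (fun i : 'I_2 => _ < _)%N) /= !big_ord_recl.
rewrite !big_ord0 /= /bump /= !addn0 !add0r !addr0 ?addn1 ?sgn expr0 expr1.
rewrite mul1r !mulN1r addrA; congr (- a _ + a _ - a _);
  apply/ffunP => m; rewrite !ffunE; case: (unliftP ord0 m) => [m' ->|->];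
  rewrite ?ffunE //=; by case: m' => -[|[|[]]].
Qed.

Lemma ce_d3E (a : kform L 3) u v t s : ce_d a (vec4 u v t s) =
  - a (vec3 (lie u v) t s) + a (vec3 (lie u t) v s) - a (vec3 (lie v t) u s)
  - a (vec3 (lie u s) v t) + a (vec3 (lie v s) u t) - a (vec3 (lie t s) u v).
Proof.
have sgn n (b : K) : (-1) ^+ n.+2 * b = (-1) ^+ n * b.
  by rewrite -addn2 exprD sqrrN expr1n mulr1.
rewrite /ce_d !big_ord_recl big_ord0.
rewrite big_pred0 // !(big_mkcond (fun i : 'I_3 => _ < _)%N) /= !big_ord_recl.
rewrite !big_ord0 /= /bump /= !addn0 !add0r !addr0 ?addn1 ?addn2 ?sgn expr0 expr1.
rewrite ?mul1r ?mulN1r !addrA.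
congr (- a _ + a _ - a _ - a _ + a _ - a _);
  apply/ffunP => m; rewrite !ffunE; case: (unliftP ord0 m) => [m' ->|->];
  rewrite ?ffunE //=; by case: m' => -[|[|[]]].
Qed.

End ChevalleyEilenberg.

(** * The form d^c omega on real vectors *)

Lemma ffun_if2 (V V' : zmodType) s (u v : V') (F G : V' -> V) :
  [ffun m => if m \in bool_set 2 s then F (vec2 u v m) else G (vec2 u v m)] =
  vec2 (if nth false s 0 then F u else G u)
       (if nth false s 1 then F v else G v).
Proof. by apply/ffunP => -[[|[|[]]] i] //; rewrite !ffunE inE. Qed.

Lemma ffun_if3 (V V' : zmodType) s (u v t : V') (F G : V' -> V) :
  [ffun m => if m \in bool_set 3 s then F (vec3 u v t m)
             else G (vec3 u v t m)] =
  vec3 (if nth false s 0 then F u else G u)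
       (if nth false s 1 then F v else G v)
       (if nth false s 2 then F t else G t).
Proof. by apply/ffunP => -[[|[|[|[]]]] i] //; rewrite !ffunE inE. Qed.

Section DcReal.
Variables (R : realType) (L : finLieAlgType R).

(** By [dc_omega] this is d^c omega on real vectors; up to sign, it is the torsion 3-form of the
    Bismut connection. *)
Definition torsion (h : {dot L for idfun}) (J : 'End(L)) (x y z : L) : R :=
  h (lie (J x) (J y)) z + h (lie (J y) (J z)) x + h (lie (J z) (J x)) y.

Definition realv (x : L) : cplx L := (x, 0).

Lemma lie_realv x y : lie (realv x) (realv y) = realv (lie x y).
Proof.
by congr pair; rewrite /= ?linear0r ?linear0l ?liexx ?linear0 ?subr0 ?addr0.
Qed.

Lemma cplx_form2E (a : kform L 2) (u v : cplx L) :
  cplx_form a (vec2 u v) =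
  ((a (vec2 u.1 v.1) - a (vec2 u.2 v.2)) +i*
   (a (vec2 u.2 v.1) + a (vec2 u.1 v.2)))%C.
Proof.
rewrite /cplx_form sum_set2 !big_bool /= !card_bool_set.
rewrite !big_ord_recl !big_ord0 /=.
rewrite !(ffun_if2 _ _ _ (fun u : cplx L => u.2) (fun u => u.1)) /=.
rewrite !addn0 !(expr0, expr1, expr2).
apply/eqP; rewrite eq_complex /=.
by apply/andP; split; apply/eqP => /=; ring.
Qed.

Lemma type_proj3E (J : 'End(L)) p (a : kform (cplx L) 3) u v t :
  let P := proj10 J in let Q := proj01 J in
  type_proj J p a (vec3 u v t) =
  match p with
  | 0 => a (vec3 (Q u) (Q v) (Q t))
  | 1 => a (vec3 (P u) (Q v) (Q t)) + a (vec3 (Q u) (P v) (Q t))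
           + a (vec3 (Q u) (Q v) (P t))
  | 2 => a (vec3 (P u) (P v) (Q t)) + a (vec3 (P u) (Q v) (P t))
           + a (vec3 (Q u) (P v) (P t))
  | 3 => a (vec3 (P u) (P v) (P t))
  | _ => 0
  end.
Proof.
move=> P Q; rewrite /type_proj sum_set3 !big_bool !card_bool_set.
rewrite !big_ord_recl !big_ord0 !(ffun_if3 _ _ _ _ P Q).
by case: p => [|[|[|[|p]]]] /=; rewrite ?addr0 ?add0r ?addrA.
Qed.

Variable (h : {dot L for idfun}) (J : 'End(L)).
Hypothesis (JJ : forall x, J (J x) = - x).
Hypothesis (JN : forall x y, nijenhuis J x y = 0).
Hypothesis (Jh : forall x y, h (J x) (J y) = h x y).

Let w : kform (cplx L) 2 := cplx_form (fundamental_form J h).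

Lemma omegaE u v : w (vec2 u v) =
  ((h (J u.1) v.1 - h (J u.2) v.2) +i* (h (J u.2) v.1 + h (J u.1) v.2))%C.
Proof. by rewrite /w cplx_form2E /fundamental_form !ffunE. Qed.

Lemma half_complex : (2^-1 : R[i]) = (2^-1 +i* 0)%C.
Proof.
apply: (@mulfI _ 2); first by rewrite pnatr_eq0.
rewrite divff ?pnatr_eq0 //; apply/eqP; rewrite eq_complex /=.
by apply/andP; split; apply/eqP => /=; field.
Qed.

Lemma proj10E u : proj10 J u = (2^-1 *: (u.1 + J u.2), 2^-1 *: (u.2 - J u.1)).
Proof.
rewrite /proj10 half_complex !cplx_scaleE /cplx_scale /cplx_end /=.
by rewrite !scale0r !scale1r sub0r add0r subr0 addr0 opprK.
Qed.

Lemma proj01E u : proj01 J u = (2^-1 *: (u.1 - J u.2), 2^-1 *: (u.2 + J u.1)).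
Proof.
rewrite /proj01 half_complex !cplx_scaleE /cplx_scale /cplx_end /=.
by rewrite !scale0r !scale1r sub0r add0r subr0 addr0.
Qed.

Let J_skew x y : h x (J y) = - h (J x) y.
Proof. exact: orthogonal_skew. Qed.

(** Invariance of [h] under [J] makes the fundamental form of type (1, 1), so that only p = 1
    contributes to [del] and [delbar]. *)
Lemma omega_type p : type_proj J p w = if p == 1%N then w else (fun _ => 0).
Proof.
apply: funext => x; rewrite (vec2E x); move: (x ord0) (x ord_max) => u v.
rewrite /type_proj sum_set2 !big_bool /= !card_bool_set.
rewrite !big_ord_recl !big_ord0 /=.
rewrite !(ffun_if2 _ _ _ (proj10 J) (proj01 J)) /=.
rewrite !omegaE !(proj10E, proj01E) /=.
case: p => [|[|[|p]]] /=; apply/eqP; rewrite eq_complex ?omegaE /=;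
  apply/andP; split; apply/eqP => /=; rewrite ?addr0 ?add0r //;
  rewrite !linearZ /= !(linearD, linearB, linearN) /= ?JJ !bilinE /=;
  rewrite !J_skew ?JJ ?linearNl /=;
  move: (h (J u.1) v.1) (h (J u.1) v.2) (h (J u.2) v.1) (h (J u.2) v.2);
  move: (h u.1 v.1) (h u.1 v.2) (h u.2 v.1) (h u.2 v.2) => *; by field.
Qed.

Lemma ce_d0 k :
  ce_d (fun _ : {ffun 'I_k.+1 -> cplx L} => 0) = (fun _ => 0 : R[i]).
Proof.
by apply: funext => y; rewrite /ce_d; do 2!(apply: big1 => ? _); rewrite mulr0.
Qed.

Lemma type_proj0 k p :
  type_proj J p (fun _ : {ffun 'I_k -> cplx L} => 0) = (fun _ => 0).
Proof. by apply: funext => y; rewrite /type_proj big1. Qed.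

Lemma del_omega x : del J w x = type_proj J 2 (ce_d w) x.
Proof.
rewrite /del !big_ord_recl big_ord0 /= !omega_type /= !ce_d0 !type_proj0.
by rewrite add0r !addr0.
Qed.

Lemma delbar_omega x : delbar J w x = type_proj J 1 (ce_d w) x.
Proof.
rewrite /delbar !big_ord_recl big_ord0 /= !omega_type /= !ce_d0 !type_proj0.
by rewrite add0r !addr0.
Qed.

Lemma proj10_real x : proj10 J (realv x) = (2^-1 *: x, - 2^-1 *: J x).
Proof. by rewrite proj10E /= linear0 addr0 sub0r scalerN scaleNr. Qed.

Lemma proj01_real x : proj01 J (realv x) = (2^-1 *: x, 2^-1 *: J x).
Proof. by rewrite proj01E /= linear0 subr0 add0r. Qed.

Lemma nijenhuis_dot x y z : h (lie (J x) (J y)) z =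
  h (J (lie (J x) y)) z + h (J (lie x (J y))) z + h (lie x y) z.
Proof.
have /(congr1 (fun t => h t z)) := JN x y.
rewrite /nijenhuis !linearBl linear0l /=.
lra.
Qed.

(** The coefficient is -1/2 in [proj10_real] and 1/2 in [proj01_real], so one formula serves all
    choices of types. *)
Lemma omega_lie (s1 s2 s3 : R) x y z :
  w (vec2 (lie ((2^-1 *: x, s1 *: J x) : cplx L)
               ((2^-1 *: y, s2 *: J y) : cplx L))
     (2^-1 *: z, s3 *: J z)) =
  let M := lie (J x) (J y) in let N := lie x y in
  let Q := lie (J x) y in let T := lie x (J y) in
  ((2^-1 * (2^-1 * 2^-1 * h (J N) z - s1 * s2 * h (J M) z)
     - s3 * (2^-1 * s2 * h T z + 2^-1 * s1 * h Q z)) +i*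
   (2^-1 * (2^-1 * s2 * h (J T) z + 2^-1 * s1 * h (J Q) z)
     + s3 * (2^-1 * 2^-1 * h N z - s1 * s2 * h M z)))%C.
Proof.
rewrite omegaE /= !(linearB, linearD) /= !bilinE /= !linearZ /= !bilinE /= !Jh.
by congr (_ +i* _)%C; ring.
Qed.

(** These are the terms of d^c omega that bracket the slots of x and y; [dc_omega] adds up the three
    pairs of slots. *)
Lemma omega_lie_types x y z :
  let P u := proj10 J (realv u) in let Q u := proj01 J (realv u) in
  (h (lie (J x) (J y)) z)%:C%C = - ('i%C *
    (w (vec2 (lie (P x) (Q y)) (Q z)) + w (vec2 (lie (Q x) (P y)) (Q z))
     + w (vec2 (lie (Q x) (Q y)) (P z))
   - (w (vec2 (lie (P x) (P y)) (Q z)) + w (vec2 (lie (P x) (Q y)) (P z))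
     + w (vec2 (lie (Q x) (P y)) (P z))))).
Proof.
move=> P Q; rewrite /P /Q !proj10_real !proj01_real !omega_lie /=.
(* Integrability, paired with [J z] and with [z], eliminates both terms that contain [Jx, Jy]. *)
have := nijenhuis_dot x y (J z); rewrite !J_skew ?JJ !linearNl /=.
have := nijenhuis_dot x y z.
move: (h (lie (J x) (J y)) z) (h (J (lie (J x) (J y))) z).
move: (h (lie x y) z) (h (J (lie x y)) z) => n n'.
move: (h (lie (J x) y) z) (h (J (lie (J x) y)) z) => q q'.
move: (h (lie x (J y)) z) (h (J (lie x (J y))) z) => t t' m m' e1 e2.
have -> : m' = n' - q - t by rewrite -[LHS]opprK e2; ring.
rewrite {}e1 {e2}.
by apply/eqP; rewrite eq_complex; apply/andP; split; apply/eqP => /=; field.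
Qed.

Lemma dc_omega x y z :
  dc J w (vec3 (realv x) (realv y) (realv z)) = (torsion h J x y z)%:C%C.
Proof.
rewrite /dc delbar_omega del_omega !type_proj3E.
have -> : torsion h J x y z = h (lie (J x) (J y)) z + h (lie (J y) (J z)) x
    - h (lie (J x) (J z)) y by rewrite /torsion (lie_antisym (J z)) linearNl.
rewrite rmorphB rmorphD /= !omega_lie_types !ce_d2E.
(* [ring] must not unfold [w] when comparing atoms. *)
have [W HW] : exists W, forall A B C, w (vec2 (lie A B) C) = W A B C.
  by exists (fun A B C => w (vec2 (lie A B) C)).
rewrite !HW {HW}; move: (proj10 J _) (proj10 J _) (proj10 J _) => a b c.
move: (proj01 J _) (proj01 J _) (proj01 J _) => d e f.
rewrite ?addr0 ?add0r; ring.
Qed.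

End DcReal.

(** * Generalized Kähler conditions in terms of the torsion *)

Section Torsion.
Variables (R : realType) (L : finLieAlgType R) (h : {dot L for idfun}).

Lemma torsion_closed (J : 'End(L)) (x y z t : L) :
  hermitian_structure J h ->
  (forall v, ce_d (dc J (cplx_form (fundamental_form J h))) v = 0) ->
  - torsion h J (lie x y) z t + torsion h J (lie x z) y t
  - torsion h J (lie y z) x t - torsion h J (lie x t) y z
  + torsion h J (lie y t) x z - torsion h J (lie z t) x y = 0.
Proof.
move=> [[JJ JN] Jh] /(_ (vec4 (realv x) (realv y) (realv z) (realv t))).
rewrite ce_d3E !lie_realv !dc_omega // -!(rmorphN, rmorphD) /=.
by move/eqP; rewrite fmorph_eq0 => /eqP.
Qed.

Lemma torsion_opp (Jp Jm : 'End(L)) (x y z : L) :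
  generalized_kahler_structure Jp Jm h ->
  torsion h Jm x y z = - torsion h Jp x y z.
Proof.
case=> -[[JJp JNp] Jhp] [[JJm JNm] Jhm] _ _.
move=> /(_ (vec3 (realv x) (realv y) (realv z))).
rewrite !dc_omega // -rmorphD /= => /eqP; rewrite fmorph_eq0 addrC addr_eq0.
by move/eqP.
Qed.

End Torsion.

(** * The Lie algebra structure *)

Section Core.
Variables (R : realType) (L : finLieAlgType R) (h : {dot L for idfun}).
Variables (J : 'End(L)) (e1 : L).
Local Notation e6 := (J e1).
Local Notation A := (lie (J e1)).
Local Notation eta x y := (h (lie x y) e1).

(** The nilradical enters only as the orthogonal of [e6], and its derived algebra as the line of
    [e1]. *)
Hypothesis hermJ : hermitian_structure J h.
Hypothesis unit1 : h e1 e1 = 1.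
Hypothesis central1 : forall x, lie e1 x = 0.
Hypothesis lie_perp6 : forall x y, h (lie x y) e6 = 0.
Hypothesis lie_nil : forall x y,
  h x e6 = 0 -> h y e6 = 0 -> lie x y = eta x y *: e1.

Let JJ : forall x, J (J x) = - x. Proof. by case: hermJ => -[]. Qed.
Let Jh : forall x y, h (J x) (J y) = h x y. Proof. by case: hermJ. Qed.
Let Jskew x y : h x (J y) = - h (J x) y.
Proof. exact: orthogonal_skew. Qed.
Let central1r x : lie x e1 = 0.
Proof. by rewrite lie_antisym central1 oppr0. Qed.

Let dot16 : h e1 e6 = 0.
Proof. have := Jskew e1 e1; rewrite [h e6 e1](dotC h); lra. Qed.

Let dot61 : h e6 e1 = 0. Proof. by rewrite (dotC h) dot16. Qed.

Let dot66 : h e6 e6 = 1. Proof. by rewrite Jh. Qed.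

(** Integrability at (e1, x): the two terms that bracket with the central [e1] vanish. *)
Let AJ x : A (J x) = J (A x).
Proof.
case: hermJ => -[_ /(_ e1 x)]; rewrite /nijenhuis !central1 linear0 !subr0.
by move/eqP; rewrite subr_eq0 => /eqP.
Qed.

(** Applying [J] to both arguments turns [e1] into [e6] and [A x] into the bracket [A (J x)]. *)
Let A_perp1 x : eta e6 x = 0.
Proof. by rewrite -Jh -AJ lie_perp6. Qed.

(** Subtract from x and y their components along [e6] and apply [lie_nil] to the rest. *)
Let lieE x y : lie x y = eta x y *: e1 + h x e6 *: A y - h y e6 *: A x.
Proof.
have perp z : h (z - h z e6 *: e6) e6 = 0.
  by rewrite !bilinE /= dot66 mulr1 subrr.
have := lie_nil (perp x) (perp y).
have -> : lie (x - h x e6 *: e6) (y - h y e6 *: e6) =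
    lie x y - h x e6 *: A y + h y e6 *: A x.
  rewrite !bilinE /= liexx !scaler0 subr0 (lie_antisym x e6) scalerN opprK.
  by rewrite addrAC.
rewrite !bilinE /= !A_perp1 !mulr0 subr0 addr0 => <-.
by rewrite addrAC addrK subrK.
Qed.

Let eta_perp1 y : eta e1 y = 0. Proof. by rewrite central1 linear0l. Qed.

Let eta_sym x y : eta y x = - eta x y.
Proof. by rewrite lie_antisym linearNl. Qed.

(** Integrability paired with [e1]: the terms of the form J[., .] vanish, because brackets are
    orthogonal to [e6]. *)
Let etaJ x y : eta (J x) (J y) = eta x y.
Proof.
case: hermJ => -[_ /(_ x y) /(congr1 (fun t => h t e1)) +] _.
rewrite /nijenhuis /= !linearBl linear0l /=.
have JE z : h z e6 = 0 -> h (J z) e1 = 0 by rewrite Jskew; lra.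
by rewrite !JE ?lie_perp6 // !subr0 => /eqP; rewrite subr_eq0 => /eqP.
Qed.

(** The Jacobi identity for e6, x, y paired with [e1]; the term [e6, [x, y]] drops by [A_perp1]. *)
Let etaA x y : eta (A x) y = - eta x (A y).
Proof.
have := congr1 (fun t => h t e1) (lie_jacobi e6 x y).
rewrite !linearDl linear0l /= A_perp1 add0r.
rewrite (lie_antisym y e6) linearNr linearNl /=.
rewrite (eta_sym (A x)); lra.
Qed.

Let torsion1 x y : torsion h J e1 x y = h (J (A x)) y + eta x y - h (J (A y)) x.
Proof. by rewrite /torsion (lie_antisym (J y)) linearNl /= !AJ etaJ. Qed.

Let torsion_cyc x y z : torsion h J x y z = torsion h J y z x.
Proof. rewrite /torsion; ring. Qed.

Let torsion_anti x y z : torsion h J x y z = - torsion h J y x z.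
Proof.
rewrite /torsion (lie_antisym (J y) (J x)) (lie_antisym (J x) (J z)).
rewrite (lie_antisym (J z) (J y)) !linearNl /=; ring.
Qed.

Hypothesis closed : forall x y z t,
  - torsion h J (lie x y) z t + torsion h J (lie x z) y t
  - torsion h J (lie y z) x t - torsion h J (lie x t) y z
  + torsion h J (lie y t) x z - torsion h J (lie z t) x y = 0.

Let torsion0 x y : torsion h J 0 x y = 0.
Proof.
by rewrite /torsion linear0 linear0l linear0r !(linear0l, linear0r) !addr0.
Qed.

(* The (e6, e1, x, J y) component of [closed]. *)
Let A_skew x y : h (A x) y = - h x (A y).
Proof.
apply: (skew_of_second_derivative (A := A)) => [|{}x {}y]; first exact: lie_linearr.
have := closed e6 e1 x (J y).
rewrite central1r !central1 !torsion0 !(torsion_anti _ e1) !torsion1.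
rewrite (torsion_cyc _ e6) (torsion_anti e6 e1) torsion1 !AJ !JJ.
rewrite central1r !oppr0 linear0l.
rewrite !Jh !A_perp1 !linearNl /=.
rewrite etaA AJ (eta_sym x) (dotC h (A y)) (dotC h _ x) mulr2n; lra.
Qed.

Let JA_sym x y : h (J (A x)) y = h (J (A y)) x.
Proof. by rewrite -[RHS]opprK -Jskew A_skew opprK AJ dotC. Qed.

(** After [lieE], the terms in J A cancel in pairs, since J A is symmetric. What is left is e^1 /\
    eta. *)
Let torsionE x y z : torsion h J x y z =
  h x e1 * eta y z + h y e1 * eta z x + h z e1 * eta x y.
Proof.
have E u v w : h (lie (J u) (J v)) w =
    eta u v * h w e1 + h u e1 * h (J (A v)) w - h v e1 * h (J (A u)) w.
  by rewrite lieE !bilinE /= etaJ !Jh !AJ (dotC h e1).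
rewrite /torsion !E (JA_sym x z) (JA_sym x y) (JA_sym y z); ring.
Qed.

(** The Jacobi identity paired with [e1]: up to sign, eta is d e^1, hence closed. *)
Let eta_closed x y z : eta (lie x z) y = eta (lie x y) z + eta (lie y z) x.
Proof.
have := congr1 (fun t => h t e1) (lie_jacobi x y z).
rewrite /= !linearDl linear0l /= !(eta_sym (lie _ _)) (lie_antisym z x).
rewrite linearNl /= linearNl /=.
lra.
Qed.

(* That is, eta /\ eta = 0: with torsionE and eta_closed, the differential of
   torsion = e^1 /\ eta is - eta /\ eta. *)
Let pluecker x y z t :
  eta x y * eta z t = eta x z * eta y t - eta x t * eta y z.
Proof.
have := closed x y z t; rewrite !torsionE !(fun a => eta_sym (lie _ _) a).
rewrite !(eta_closed x y) !(eta_closed x z t) !(eta_closed y z t).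
lra.
Qed.

(** * The second complex structure *)

Variable I : 'End(L).
Hypothesis hermI : hermitian_structure I h.
Hypothesis torsionI : forall x y z, torsion h I x y z = - torsion h J x y z.

Let II : forall x, I (I x) = - x. Proof. by case: hermI => -[]. Qed.
Let Ih : forall x y, h (I x) (I y) = h x y. Proof. by case: hermI. Qed.
Let Iskew x y : h x (I y) = - h (I x) y.
Proof. exact: orthogonal_skew. Qed.

Local Notation u := (I e1).
Local Notation f := (I e6).

Let adI x : lie u (I x) = I (lie u x).
Proof.
case: hermI => -[_ /(_ e1 x)]; rewrite /nijenhuis !central1 linear0 !subr0.
by move/eqP; rewrite subr_eq0 => /eqP.
Qed.

Let adE x : lie u x = eta u x *: e1 + h u e6 *: A x - h x e6 *: A u.
Proof. exact: lieE. Qed.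

(* [torsionI] at (e1, y, - I t), with ad u expanded. *)
Let eta_I_defect y t : eta (I y) t - eta y (I t) =
  eta u y * h t e1 - h y e6 * h (A u) t + eta u t * h y e1 - h t e6 * h (A u) y.
Proof.
have E : - h (lie u y) t + eta (I y) t - h (lie u t) y = eta y (I t).
  have := torsionI e1 y (- I t); rewrite torsionE /torsion.
  rewrite !linearN /= !II !opprK adI !linearNr /= Ih.
  rewrite (lie_antisym t) linearNl /=.
  rewrite unit1 (eta_sym e1) !eta_perp1 [h (- lie _ _) _]linearNl => ->; ring.
rewrite (adE y) (adE t) !linearBl !linearDl !linearZl_LR /= in E.
rewrite (A_skew t y) (dotC h t) !(dotC h e1) in E; lra.
Qed.

Let u_perp1 : h u e1 = 0.
Proof. by have := Iskew e1 e1; rewrite (dotC h e1); lra. Qed.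

Let f_perp6 : h f e6 = 0.
Proof. by have := Iskew e6 e6; rewrite (dotC h e6); lra. Qed.

Let Au_perpu : h (A u) u = 0.
Proof. by have := A_skew u u; rewrite (dotC h u); lra. Qed.

(** [eta_I_defect] at y = e6, where eta(e6, .) = 0. *)
Let eta_f t : eta f t = - h (A u) t.
Proof.
have := eta_I_defect e6 t; rewrite !A_perp1 (eta_sym e6) A_perp1.
rewrite dot61 dot66 lie_perp6.
lra.
Qed.

(** [eta_I_defect] at y = u, where I u = - e1 is central. *)
Let eta_u t : eta u (I t) = h u e6 * h (A u) t.
Proof.
have := eta_I_defect u t; rewrite II linearNl linearNl /= eta_perp1.
rewrite liexx linear0l /=.
rewrite u_perp1 Au_perpu; lra.
Qed.

(** Two computations of [u, f]: by [adI] it is - I (A u), and [adE] expands it. *)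
Let I_Au : I (A u) = - (eta u f *: e1) - h u e6 *: A f.
Proof.
have E := adI e6.
rewrite adE f_perp6 scale0r subr0 (lie_antisym u e6) linearN /= in E.
by rewrite -[LHS]opprK -E opprD.
Qed.

Let eta_uf : eta u f = 0.
Proof.
have : h (I (A u)) e1 = 0 by rewrite -[LHS]opprK -Iskew Au_perpu oppr0.
rewrite I_Au !bilinE /= A_perp1 unit1; lra.
Qed.

Let Au0 : A u = 0.
Proof.
(* Take t = - I (A u) in [eta_u]; skewness of [I] makes A u orthogonal to I (A u). *)
have etaAu : eta u (A u) = 0.
  have := eta_u (- I (A u)); rewrite linearN /= II opprK => ->.
  rewrite linearNr /= Iskew; have := Iskew (A u) (A u).
  rewrite (dotC h (A u)) => E.
  by rewrite (_ : h (I (A u)) (A u) = 0) ?oppr0 ?mulr0 //; lra.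
have [//|Au0] := eqVneq (A u) 0.
(* The Plücker relation on (u, f, z, A u) reduces to eta(u, z) |A u|^2 = 0. *)
have eta_u0 z : eta u z = 0.
  have := pluecker u f z (A u); rewrite eta_uf etaAu eta_f mul0r mul0r subr0.
  move/esym/eqP; rewrite mulf_eq0 oppr_eq0 => /orP [/eqP //|].
  by rewrite gt_eqF // dot_gt0.
(* Now [eta_u] forces h(u, e6) = 0, and [I_Au] then gives I (A u) = 0. *)
have /eqP := eta_u (A u); rewrite eta_u0 eq_sym mulf_eq0.
have -> : (h (A u) (A u) == 0) = false by rewrite gt_eqF // dot_gt0.
rewrite orbF => /eqP a0; have := I_Au; rewrite eta_uf a0 !scale0r subr0 oppr0.
by move=> IAu0; rewrite -[A u]opprK -(II (A u)) IAu0 linear0 oppr0.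
Qed.

Let eta_I y t : eta (I y) t = eta y (I t).
Proof.
have eta_u0 z : eta u z = 0.
  by have := eta_u (- I z); rewrite linearN /= II opprK Au0 linear0l mulr0.
have := eta_I_defect y t; rewrite !eta_u0 Au0 !linear0l; lra.
Qed.

(** Together with [lie_nil], this makes all brackets vanish on the orthogonal of [e6]. *)
Lemma nilradical_abelian x y : eta x y = 0.
Proof.
have etaxI z : eta z (I z) = 0 by have := eta_I z z; rewrite (eta_sym z); lra.
have := pluecker x y (I x) (I y); rewrite !etaxI eta_I II.
rewrite linearNr /= linearNl /=.
rewrite -(eta_I y x) (eta_sym x (I y)) => E.
have : eta x y ^+ 2 + eta x (I y) ^+ 2 = 0 by lra.
move/eqP; rewrite paddr_eq0 ?sqr_ge0 // => /andP [/eqP/eqP].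
by rewrite sqrf_eq0 => /eqP.
Qed.

End Core.

(** * Ideals of dimension one *)

Section LineIdeals.
Variables (F : fieldType) (L : finLieAlgType F).
Implicit Types (n U W : {vspace L}) (x e : L).

Lemma ad_lie x y : ad x y = lie x y.
Proof.
pose lx : {linear L -> L} :=
  HB.pack (lie x) (GRing.isLinear.Build F L L _ (lie x) (lie_linearr x)).
exact: (lfunE lx).
Qed.

Lemma lie_space_ideal U W :
  is_ideal U -> is_ideal W -> is_ideal (lie_space U W).
Proof.
move=> idU idW x y.
(* The vectors that [ad x] sends into [U, W] form a subspace, so brackets of elements of U and W
   suffice; there the Jacobi identity applies. *)
have /subvP : (lie_space U W <= ad x @^-1: lie_space U W)%VS.
  apply/lie_space_subP => a b aU bW; rewrite -memv_preim ad_lie.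
  have := lie_jacobi x a b.
  rewrite (lie_antisym b x) (lie_antisym b) linearNr /=.
  move/eqP; rewrite -addrA -opprD addr_eq0 opprK => /eqP ->.
  by rewrite rpredD ?mem_lie_space ?idU ?idW.
by move=> sub yUW; have := sub y yUW; rewrite -memv_preim ad_lie.
Qed.

(** An element of n acts on e by a scalar; were it nonzero, e would survive in every term of the
    lower central series. *)
Lemma nilpotent_line_central n e : is_nilpotent n -> e != 0 ->
  lower_central n 1 = <[e]>%VS -> e \in n -> lower_central n 2 = 0%VS.
Proof.
move=> [l nl0] e0 n1e en; apply/eqP; rewrite -subv0.
apply/lie_space_subP => x y xn.
rewrite -/(lower_central n 1) n1e => /vlineP [k ->].
rewrite linearZr /= memvZ // memv0; apply: contraTT isT => xe0.
have /vlineP [c xe] : lie x e \in <[e]>%VS by rewrite -n1e mem_lie_space.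
have c0 : c != 0 by apply: contraNneq xe0 => c0; rewrite xe c0 scale0r.
suff : e \in lower_central n l by rewrite nl0 memv0 (negPf e0).
elim: l {nl0} => //= l IH; rewrite -[e](scalerK c0) -xe memvZ ?mem_lie_space //.
Qed.

Lemma end_trace_scale (V : vectType F) (c : F) :
  end_trace (c *: \1%VF : 'End(V)) = c *+ \dim {:V}.
Proof.
rewrite /end_trace.
have -> := GRing.scalable_linear
  (passmx.mxof_linear (vbasis {:V}) (vbasis {:V})) c \1%VF.
rewrite passmx.mxof1 ?(basis_free (vbasisP _)) //.
by rewrite mxtraceZ mxtrace1 mulr_natr.
Qed.

End LineIdeals.

Section Line.
Variables (R : realType) (L : finLieAlgType R).

(** Used with U = n^1 and n^2 = 0: f acts on the quotient as the scalar c, so its trace is c times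
    the dimension. *)
Lemma quot_end_eigenline (U : {vspace L}) (f : 'End(L)) e (c : R) : e != 0 ->
  U = <[e]>%VS -> f e = c *: e ->
  end_trace (quot_end U 0%VS f) = 0 -> c = 0.
Proof.
move=> e0 -> fe.
have -> : quot_end <[e]> 0 f = c *: \1%VF.
  apply/lfunP => v; rewrite scale_lfunE id_lfunE /quot_end.
  do 2!rewrite comp_lfunE.
  have /vlineP [k vk] := quot_repr_mem v.
  rewrite -[v in RHS]quot_reprK vk; move: (quot_proj _ _) => q.
  by rewrite !linearZ /= fe linearZ /= !scalerA mulrC.
rewrite end_trace_scale => /eqP; rewrite mulrn_eq0 => /orP [|/eqP //].
(* The quotient is nonzero because it contains the class of e. *)
rewrite dimv_eq0 => /eqP V0.
have : quot_proj <[e]> 0 e \in fullv by rewrite memvf.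
rewrite V0 memv0 quot_proj_eq0 ?memv_line ?sub0v // memv0 => /eqP E.
by rewrite E eqxx in e0.
Qed.
End Line.

(** * From the nilradical to the vectors [e1] and [e6] *)

Theorem proposition8p1 (R : realType) (g : finLieAlgType R)
    (n : {vspace g}) :
  \dim {:g} = 6%N ->
  almost_nilpotent n ->
  strongly_unimodular n ->
  ~ (exists (J : 'End(g)) (h : {dot g for idfun}), kahler_structure J h) ->
  \dim (lower_central n 1) = 1%N ->
  ~ (exists (Jp Jm : 'End(g)) (h : {dot g for idfun}),
       generalized_kahler_structure Jp Jm h /\
       (Jp @: lower_central n 1)%VS = orthov h n).
Proof.
move=> _ [_ [idn niln _] dimn] SU _ dim1 [Jp [Jm [h [GK Jn1]]]].
have n1_neq0 : lower_central n 1 != 0%VS by rewrite -dimv_eq0 dim1.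
have [e1 e1n1 unit1] : exists2 e, e \in lower_central n 1 & h e e = 1.
  exact: unit_vector.
have e1_neq0 : e1 != 0 by rewrite -(dot_gt0 h) unit1.
have n1E : lower_central n 1 = <[e1]>%VS.
  by apply/esym/eqP; rewrite eqEdim -memvE e1n1 dim1 dim_vline e1_neq0.
have n1_ideal : is_ideal (lower_central n 1) by apply: lie_space_ideal.
have e1n : e1 \in n.
  move: e1 e1n1 {e1_neq0 n1E unit1}.
  by apply/subvP/lie_space_subP => x y _; apply: idn.
have n2 := nilpotent_line_central niln e1_neq0 n1E e1n.
have central1 x : lie e1 x = 0.
  have /vlineP [c xe] : lie x e1 \in <[e1]>%VS by rewrite -n1E; apply: n1_ideal.
  (* The eigenvalue of [ad x] on n^1 = n^1/n^2 is zero by strong unimodularity at l = 1. *)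
  have := SU x 1%N; rewrite n2 => /(quot_end_eigenline e1_neq0 n1E) c0.
  by rewrite lie_antisym xe (c0 c) ?scale0r ?oppr0 // ad_lie.
have [hermp hermm closedp _ _] := GK; have [_ Jph] := hermp.
pose e6 := Jp e1.
have e6_perp y : y \in n -> h y e6 = 0.
  have : e6 \in orthov h n by rewrite -Jn1 memv_img.
  by move=> /mem_orthovP H yn; rewrite (dotC h); apply: H.
have h66 : h e6 e6 = 1 by rewrite Jph.
(* Since n has codimension one and [e6] is a unit vector orthogonal to n, the two span
   everything. *)
have full : (n + <[e6]>)%VS = fullv.
  apply/eqP; rewrite eqEdim subvf dimn dimv_disjoint_sum.
    by rewrite dim_vline -(dot_gt0 h) h66 ltr01 addn1 /= ltnSn.
  apply/eqP; rewrite -subv0; apply/subvP => x; rewrite memv_cap memv0.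
  case/andP => xn /vlineP [c xc]; move: (e6_perp _ xn).
  rewrite xc linearZl_LR /= h66 mulr1.
  by move=> ->; rewrite scale0r.
have dec x : exists2 y, y \in n & x = y + h x e6 *: e6.
  have : x \in (n + <[e6]>)%VS by rewrite full memvf.
  case/memv_addP => y yn [_ /vlineP [c ->] ->]; exists y => //.
  by rewrite linearDl linearZl_LR /= e6_perp // h66 add0r mulr1.
have perp_mem x : h x e6 = 0 -> x \in n.
  by case: (dec x) => y yn + hx; rewrite hx scale0r addr0 => ->.
have lie_perp6 x y : h (lie x y) e6 = 0.
  (* Split both arguments along n and [e6]: n is an ideal and [e6, e6] = 0, so all brackets lie in
     n. *)
  apply: e6_perp; have [y' y'n ->] := dec y.
  rewrite linearDr linearZr /= rpredD ?idn //.
  rewrite memvZ // lie_antisym memvN; have [x' x'n ->] := dec x.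
  by rewrite linearDr linearZr /= liexx scaler0 addr0 idn.
have lie_nil x y : h x e6 = 0 -> h y e6 = 0 -> lie x y = h (lie x y) e1 *: e1.
  move=> /perp_mem xn /perp_mem yn.
  have /vlineP [c ->] : lie x y \in <[e1]>%VS by rewrite -n1E mem_lie_space.
  by rewrite linearZl_LR /= unit1 mulr1.
case/negP: n1_neq0; rewrite -subv0; apply/lie_space_subP => x y xn yn.
rewrite memv0 lie_nil ?e6_perp //.
rewrite (nilradical_abelian hermp unit1 central1 lie_perp6 lie_nil _ hermm).
- by rewrite scale0r.
- by move=> *; apply: torsion_closed.
- by move=> *; apply: torsion_opp.
Qed.
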